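(* Let $\Bbbk$ be a field with $\mathrm{char}(\Bbbk)\ne2$, $n\ge2$, $\mathbb{H}_{2^n}$ the Nichols Hopf algebra and $A$ a unital associative $\Bbbk$-algebra. Let $\rho:A\to A\otimes\mathbb{H}_{2^n}$ be a linear map, written $\rho(a)=a^0\otimes a^1$, such that $A_1:=(1^*-g^* )(1^1)1^0=0$ and $w_i:=(x_i^*-(gx_i)^* )(1^1)1^0\in Z(A)$ for all $i\in\{1,\dots,n-1\}$. Then $\rho$ is a partial coaction of $\mathbb{H}_{2^n}$ on $A$ if and only if $$\rho(a)=a\otimes\frac{1+g}{2}-\sum_{i=1}^{n-1}w_ia\otimes gx_i\quad\text{for all }a\in A.$$ Moreover, all these partial coactions are symmetric.
   Context: $\mathbb{H}_{2^n}$ is the Hopf algebra generated by $g,x_1,\dots,x_{n-1}$ with relations $g^2=1$, $x_i^2=0$, $x_ig=-gx_i$, $x_ix_j=-x_jx_i$, basis $\{g^{j_0}x_1^{j_1}\cdots x_{n-1}^{j_{n-1}}:j_i\in\{0,1\}\}$, $g$ group-like, $\Delta(x_i)=x_i\otimes1+g\otimes x_i$, $\varepsilon(x_i)=0$. For a basis element $b$, $b^*$ denotes the corresponding element of the dual basis. $Z(A)$ is the center of $A$. For a bialgebra $H$, a partial coaction of $H$ on $A$ is a linear map $\rho:A\to A\otimes H$ such that $(I\otimes\varepsilon)\rho(a)=a$, $\rho(ab)=\rho(a)\rho(b)$ and $(\rho\otimes I)\rho(a)=(\rho(1_A)\otimes1_H)((I\otimes\Delta)\rho(a))$ for all $a,b\in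 A$; it is symmetric if moreover $(\rho\otimes I)\rho(a)=((I\otimes\Delta)\rho(a))(\rho(1_A)\otimes1_H)$ for all $a$. *)

(* Defs.v *)
From HB Require Import structures.
From mathcomp Require Import all_boot all_order all_algebra.
Set Implicit Arguments. Unset Strict Implicit. Unset Printing Implicit Defensive.
Import Order.TTheory GRing.Theory Num.Theory.
Local Open Scope ring_scope.

(* The Nichols Hopf algebra H_{2^n}, with m = n-1 skew-primitive generators
   x_0, ..., x_{m-1} (paper's x_1, ..., x_{n-1}), given by its basis
   g^a x_S, S = {s_1 < ... < s_k}, x_S = x_{s_1} ... x_{s_k}. *)
Definition HB (m : nat) := (bool * {set 'I_m})%type.

Definition hunit {m} : HB m := (false, set0).
Definition hg {m} : HB m := (true, set0).
Definition hx {m} (i : 'I_m) : HB m := (false, [set i]).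
Definition hgx {m} (i : 'I_m) : HB m := (true, [set i]).

(* structure constants: (g^a x_S)(g^b x_T) = (-1)^(b|S| + inv(S,T)) g^(a+b) x_(S u T)
   if S, T disjoint, 0 otherwise; inv(S,T) = #{(s,t) in S x T | t < s}. *)
Definition hsign {m} (b1 b2 : HB m) : nat :=
  (b2.1 * #|b1.2| + #|[set p : 'I_m * 'I_m | (p.1 \in b1.2) && (p.2 \in b2.2) && (p.2 < p.1)%N]|)%N.

Definition hcoef {m} (R : pzRingType) (b1 b2 b : HB m) : R :=
  if [disjoint b1.2 & b2.2] && (b == (b1.1 (+) b2.1, b1.2 :|: b2.2))
  then (-1) ^+ hsign b1 b2 else 0.

(* H (x) H, as coefficient functions on pairs of basis elements *)
Definition mulHH {m} (k : fieldType) (u v : {ffun HB m * HB m -> k}) : {ffun HB m * HB m -> k} :=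
  [ffun c => \sum_p \sum_q (hcoef k p.1 q.1 c.1 * hcoef k p.2 q.2 c.2) * (u p * v q)].
Definition deltaHH {m} (k : fieldType) (p : HB m * HB m) : {ffun HB m * HB m -> k} :=
  [ffun q => (q == p)%:R].
Definition unitHH {m} (k : fieldType) : {ffun HB m * HB m -> k} := deltaHH k (hunit, hunit).

(* comultiplication: Delta(g) = g (x) g, Delta(x_i) = x_i (x) 1 + g (x) x_i,
   extended multiplicatively to the basis g^a x_{s_1} ... x_{s_k}. *)
Definition DeltaG {m} (k : fieldType) : {ffun HB m * HB m -> k} := deltaHH k (hg, hg).
Definition DeltaX {m} (k : fieldType) (i : 'I_m) : {ffun HB m * HB m -> k} :=
  deltaHH k (hx i, hunit) + deltaHH k (hg, hx i).
Definition Delta {m} (k : fieldType) (b : HB m) : {ffun HB m * HB m -> k} :=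
  mulHH (if b.1 then DeltaG k else unitHH k)
        (foldr (fun i acc => mulHH (DeltaX k i) acc) (unitHH k)
               [seq i <- enum 'I_m | i \in b.2]).

Definition epsH {m} (k : fieldType) (b : HB m) : k := (b.2 == set0)%:R.

(* A (x) H as {ffun HB m -> A}, A (x) H (x) H as {ffun HB m * HB m -> A} *)
Section Tensors.
Variables (m : nat) (k : fieldType) (A : algType k).

Definition mulAH (u v : {ffun HB m -> A}) : {ffun HB m -> A} :=
  [ffun b => \sum_b1 \sum_b2 hcoef k b1 b2 b *: (u b1 * v b2)].

Definition mulAHH (u v : {ffun HB m * HB m -> A}) : {ffun HB m * HB m -> A} :=
  [ffun c => \sum_p \sum_q (hcoef k p.1 q.1 c.1 * hcoef k p.2 q.2 c.2) *: (u p * v q)].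

Definition tens (a : A) (b : HB m) : {ffun HB m -> A} := [ffun e => if e == b then a else 0].

Variable rho : A -> {ffun HB m -> A}.

Definition rhoI_rho (a : A) : {ffun HB m * HB m -> A} := [ffun p => rho (rho a p.2) p.1].
Definition IDelta_rho (a : A) : {ffun HB m * HB m -> A} :=
  [ffun p => \sum_e Delta k e p *: rho a e].
Definition rho1_1 : {ffun HB m * HB m -> A} :=
  [ffun p => if p.2 == hunit then rho 1 p.1 else 0].

Definition is_partial_coaction : Prop :=
  [/\ forall a, \sum_b epsH k b *: rho a b = a,
      forall a b, rho (a * b) = mulAH (rho a) (rho b) &
      forall a, rhoI_rho a = mulAHH rho1_1 (IDelta_rho a)].

Definition is_symmetric_partial_coaction : Prop :=
  is_partial_coaction /\ forall a, rhoI_rho a = mulAHH (IDelta_rho a) rho1_1.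

End Tensors.

(* Main.v *)
(* Grade H by the number of factors x_i and compare coefficients in the axioms
   applied to products 1 a and a 1.
   Degree 0: A_1 = 0 and counitality force rho(1) to start with 1/2 (1 + g), and
   rho(a) = rho(1) rho(a) gives a/2 at both 1 and g.
   Degree 1: write alpha, beta for the coefficients of x_i and g x_i in rho(a).
   The coaction axiom at x_i (x) 1 gives alpha = 0 when a = 1; then
   rho(a) = rho(1) rho(a) and rho(a) = rho(a) rho(1) read alpha - beta = w_i a and
   alpha + beta = - a w_i, so centrality of w_i gives alpha = 0, beta = - w_i a.
   Degree at least 2: the coaction axiom in bidegree (d - 1, 1) kills everything,
   by induction on d.
   Conversely, each axiom for the explicit formula is an identity between
   bilinear expressions in rho; the terms w_i w_j (x) g x_i g x_j cancel because
   the w_i commute while the g x_i anticommute. *)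
Require Import Defs.
From HB Require Import structures.
From mathcomp Require Import all_boot all_order all_algebra.
From mathcomp Require Import ring.
Import GRing.Theory.
Local Open Scope ring_scope.
Set Implicit Arguments. Unset Strict Implicit. Unset Printing Implicit Defensive.

(** * Structure constants of the Nichols Hopf algebra *)

Section Basis.
Variables (m : nat) (k : fieldType).
Implicit Types (b c p q r : HB m) (i : 'I_m).

(* The only basis element [q] for which [c] can occur in the product [r q]. *)
Definition ldiv r c : HB m := (r.1 (+) c.1, c.2 :\: r.2).

Lemma hsign_l0 (j : bool) q : hsign (j, set0) q = 0%N.
Proof.
rewrite /hsign /= cards0 muln0 add0n; apply: eq_card0 => x.
by rewrite !inE.
Qed.

Lemma hsign_r0 r (j : bool) : hsign r (j, set0) = (j * #|r.2|)%N.
Proof.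
rewrite /hsign /= -[RHS]addn0; congr (_ + _)%N; apply: eq_card0 => x.
by rewrite !inE andbF.
Qed.

(** The xor of exponents cancels, and a disjoint union with [r.2] equal to [c.2] leaves only the
    complement [c.2 :\: r.2] for [q.2]. This form collapses every sum over [q] to one term. *)
Lemma hcoefE r q c :
  hcoef k r q c =
    if (r.2 \subset c.2) && (q == ldiv r c) then (-1) ^+ hsign r q else 0.
Proof.
rewrite /hcoef; congr (if _ then _ else _).
case: r q c => [j R] [l Q] [h C] /=; rewrite /ldiv /= !xpair_eqE.
apply/andP/andP => [[dRQ /andP[/eqP-> /eqP->]] | [sRC /andP[/eqP-> /eqP->]]].
  rewrite subsetUl addKb setDUl setDv set0U eqxx /=; split=> //.
  by rewrite eq_sym; apply/eqP/setDidPl; rewrite disjoint_sym.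
rewrite addKb eqxx /= disjoint_sym -setI_eq0 setIDAC setDIl setDv setI0 eqxx.
by rewrite -{1}(setIidPr sRC) setID.
Qed.

Lemma sum_hcoefl (V : lmodType k) r c (F : HB m -> V) :
  \sum_q hcoef k r q c *: F q =
    if r.2 \subset c.2 then (-1) ^+ hsign r (ldiv r c) *: F (ldiv r c) else 0.
Proof.
rewrite (bigD1 (ldiv r c)) //= big1 => [|q neq]; last first.
  by rewrite hcoefE (negPf neq) andbF scale0r.
by rewrite addr0 hcoefE eqxx andbT; case: ifP; rewrite ?scale0r.
Qed.

Lemma hcoef_unitl q c : hcoef k hunit q c = (c == q)%:R.
Proof.
rewrite /hcoef hsign_l0 /= -setI_eq0 set0I eqxx /= set0U.
by rewrite -surjective_pairing; case: eqP.
Qed.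

Lemma hcoef_unitr r c : hcoef k r hunit c = (c == r)%:R.
Proof.
rewrite /hcoef hsign_r0 /= -setI_eq0 setI0 eqxx /= setU0 addbF.
by rewrite -surjective_pairing; case: eqP.
Qed.

Lemma mulHHDl (u v w : {ffun HB m * HB m -> k}) :
  mulHH (u + v) w = mulHH u w + mulHH v w.
Proof.
apply/ffunP => c; rewrite !ffunE -big_split; apply: eq_bigr => p _.
rewrite -big_split; apply: eq_bigr => q _.
by rewrite ffunE mulrDl mulrDr.
Qed.

Lemma mulHH_deltal (r c : HB m * HB m) (v : {ffun HB m * HB m -> k}) :
  mulHH (deltaHH k r) v c =
    if (r.1.2 \subset c.1.2) && (r.2.2 \subset c.2.2)
    then (-1) ^+ hsign r.1 (ldiv r.1 c.1) * (-1) ^+ hsign r.2 (ldiv r.2 c.2)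
         * v (ldiv r.1 c.1, ldiv r.2 c.2)
    else 0.
Proof.
rewrite ffunE (bigD1 r) //= addrC big1 => [|p neq]; last first.
  by apply: big1 => q _; rewrite ffunE (negPf neq) mul0r mulr0.
(* The sum over pairs is nested so that [sum_hcoefl] applies once per leg; [k^o] views the scalars
   as a module over themselves. *)
rewrite add0r; transitivity (\sum_q1 hcoef k r.1 q1 c.1 *:
  (\sum_q2 hcoef k r.2 q2 c.2 *: (v (q1, q2) : k^o))).
  under [RHS]eq_bigr do rewrite scaler_sumr.
  rewrite pair_big; apply: eq_bigr => -[q1 q2] _ /=.
  by rewrite ffunE eqxx mul1r scalerA.
rewrite sum_hcoefl sum_hcoefl.
by case: subsetP => // _; case: subsetP => // _; rewrite ?scaler0 // scalerA.
Qed.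

Lemma ldiv_unit c : ldiv hunit c = c.
Proof. by rewrite /ldiv /= setD0 -surjective_pairing. Qed.

Lemma mulHH_unitr (u : {ffun HB m * HB m -> k}) : mulHH u (unitHH k) = u.
Proof.
apply/ffunP => c; rewrite ffunE (bigD1 c) //= [X in _ + X]big1 ?addr0 => [|p neq].
  rewrite (bigD1 (hunit, hunit)) //= [X in _ + X]big1 ?addr0 => [|q neq].
    by rewrite !hcoef_unitr !eqxx ffunE eqxx !mul1r mulr1.
  by rewrite [unitHH k q]ffunE (negPf neq) !mulr0.
apply: big1 => q _; rewrite [unitHH k q]ffunE.
case: eqP => [->|_]; rewrite ?mulr0 // !hcoef_unitr -natrM mulnb.
have -> : (c.1 == p.1) && (c.2 == p.2) = (c == p).
  by case: c p {neq} => c1 c2 [p1 p2].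
by rewrite eq_sym (negPf neq) mul0r.
Qed.

(** * Comultiplication on the basis *)

Definition DeltaXs (l : seq 'I_m) : {ffun HB m * HB m -> k} :=
  foldr (fun i acc => mulHH (DeltaX k i) acc) (unitHH k) l.

(** The summand [x_i (x) 1] removes [i] from the left leg; [g (x) x_i] removes it from the right leg
    and flips the exponent of [g] on the left. *)
Lemma DeltaXs_cons i l (c : HB m * HB m) : DeltaXs (i :: l) c =
  (if i \in c.1.2 then (-1) ^+ hsign (hx i) (ldiv (hx i) c.1) *
     DeltaXs l ((c.1.1, c.1.2 :\ i), c.2) else 0) +
  (if i \in c.2.2 then (-1) ^+ hsign (hx i) (ldiv (hx i) c.2) *
     DeltaXs l ((~~ c.1.1, c.1.2), (c.2.1, c.2.2 :\ i)) else 0).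
Proof.
rewrite /= mulHHDl ffunE !mulHH_deltal /= !hsign_l0 !sub0set !sub1set andbT.
rewrite ldiv_unit /ldiv /= setD0 expr0 mulr1 mul1r.
by congr (_ + _); case: ifP.
Qed.

Lemma DeltaE b (c : HB m * HB m) :
  Delta k b c = DeltaXs [seq i <- enum 'I_m | i \in b.2]
                  ((b.1 (+) c.1.1, c.1.2), (b.1 (+) c.2.1, c.2.2)).
Proof.
case: b => [[] S]; rewrite /Delta /= -/(DeltaXs _) mulHH_deltal /= !sub0set /=;
  by rewrite !hsign_l0 !mul1r /ldiv /= !setD0.
Qed.

(* The last clause says that [c.1.2] and [c.2.2] partition [l]. *)
Definition DeltaXs_supp (l : seq 'I_m) (c : HB m * HB m) : bool :=
  [&& c.2.1 == false, c.1.1 == odd #|c.2.2| &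
    [forall x, ((x \in c.1.2) + (x \in c.2.2))%N == (x \in l) :> nat]].

(** Each [x_i] goes to exactly one leg, and each one sent right leaves a [g] on the left, whence the
    parity condition. On the support the coefficient is a sign; stating that its square is 1 avoids
    computing that sign. *)
Lemma DeltaXs_spec l (c : HB m * HB m) : uniq l ->
  if DeltaXs_supp l c then DeltaXs l c * DeltaXs l c = 1 else DeltaXs l c = 0.
Proof.
elim: l c => [|i l IHl] c.
  move=> _; rewrite /DeltaXs_supp /DeltaXs /= ffunE.
  case: c => [[j1 T1] [j2 T2]] /=; rewrite !xpair_eqE.
  case: ifP => [/and3P[/eqP-> /eqP-> /forallP T0] | /negbT nz].
    have T10 : T1 = set0.
      by apply/setP => x; move: (T0 x); rewrite !inE; case: (x \in T1).
    have T20 : T2 = set0.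
      by apply/setP => x; move: (T0 x); rewrite !inE addnC; case: (x \in T2).
    by rewrite T10 T20 cards0 !eqxx mulr1.
  set t := (X in (nat_of_bool X)%:R); have -> // : t = false.
  apply: contraNF nz => /andP[/andP[/eqP-> /eqP T10] /andP[/eqP-> /eqP T20]].
  rewrite T10 T20 cards0 /=; apply/forallP => x.
  by rewrite !inE.
move=> /= /andP[il ul]; rewrite DeltaXs_cons.
set c1 := (_, c.2); set c2 := (_, (c.2.1, _)).
have:= (IHl c1 ul, IHl c2 ul).
have E0 x : x != i -> (x \in i :: l) = (x \in l) by rewrite inE => /negPf->.
have ii : i \in i :: l by rewrite mem_head.
have S1 : i \in c.1.2 -> i \notin c.2.2 -> DeltaXs_supp (i :: l) c = DeltaXs_supp l c1.
  move=> i1 i2; congr [&& _, _ & _]; apply: eq_forallb => x /=.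
  rewrite in_setD1; case: (eqVneq x i) => [->|/E0-> //].
  by rewrite i1 (negPf i2) (negPf il) ii.
have S2 : i \notin c.1.2 -> i \in c.2.2 -> DeltaXs_supp (i :: l) c = DeltaXs_supp l c2.
  move=> i1 i2; congr [&& _, _ & _] => /=.
    by rewrite (cardsD1 i c.2.2) i2 oddS; case: (c.1.1); case: odd.
  apply: eq_forallb => x /=.
  rewrite in_setD1; case: (eqVneq x i) => [->|/E0-> //].
  by rewrite i2 (negPf i1) (negPf il) ii.
have Zi l' (c' : HB m * HB m) : ((i \in c'.1.2) + (i \in c'.2.2))%N != (i \in l') :> nat ->
    DeltaXs_supp l' c' = false.
  move=> ne; apply/negP => /and3P[_ _ /forallP/(_ i)]; exact/negP.
have sq (s : k) (n : nat) : ((-1) ^+ n * s) * ((-1) ^+ n * s) = s * s.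
  by rewrite mulrACA -expr2 sqrr_sign mul1r.
(* If [i] lies in both legs or in neither, everything is off the support. Otherwise exactly one
   summand of the recursion survives. *)
case: (boolP (i \in c.1.2)) => i1; case: (boolP (i \in c.2.2)) => i2.
- rewrite (Zi _ c) ?i1 ?i2 ?ii // (Zi _ c1) ?(Zi _ c2) /= ?i1 ?i2 ?setD11 ?(negPf il) //.
  by case=> -> ->; rewrite !mulr0 addr0.
- case=> D _; rewrite S1 ?i2 // addr0; case: ifP D => _ D; last by rewrite D mulr0.
  by rewrite sq.
- case=> _ D; rewrite S2 ?i1 // add0r; case: ifP D => _ D; last by rewrite D mulr0.
  by rewrite sq.
- by move=> _; rewrite (Zi _ c) ?(negPf i1) ?(negPf i2) ?ii //= addr0.
Qed.

(** The terms of [Delta (g^a x_S)] are, up to sign, [g^(a+|T|) x_(S :\: T) (x) g^a x_T] for [T]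
    contained in [S]. *)
Definition Delta_supp b (c : HB m * HB m) : bool :=
  [&& c.2.1 == b.1, c.1.1 == b.1 (+) odd #|c.2.2| &
    [forall x, ((x \in c.1.2) + (x \in c.2.2))%N == (x \in b.2) :> nat]].

Lemma Delta_spec b (c : HB m * HB m) :
  if Delta_supp b c then Delta k b c * Delta k b c = 1 else Delta k b c = 0.
Proof.
rewrite DeltaE; set l := filter _ _; set c' := (_, (_, _)).
have -> : Delta_supp b c = DeltaXs_supp l c'.
  congr [&& _, _ & _] => /=; first by case: (b.1); case: (c.2.1).
    by case: (b.1); case: (c.1.1); case: odd.
  by apply: eq_forallb => x; rewrite mem_filter mem_enum andbT.
by apply: DeltaXs_spec; rewrite filter_uniq ?enum_uniq.
Qed.

Lemma Delta_eq0 b (c : HB m * HB m) : ~~ Delta_supp b c -> Delta k b c = 0.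
Proof. by move/negPf => nS; move: (Delta_spec b c); rewrite nS. Qed.

Lemma Delta_hunit (c : HB m * HB m) : Delta k hunit c = (c == (hunit, hunit))%:R.
Proof.
rewrite DeltaE /= (@eq_filter _ _ pred0) ?filter_pred0 => [|x]; last first.
  by rewrite inE.
by rewrite ffunE /= -!surjective_pairing.
Qed.

Lemma Delta_hg (c : HB m * HB m) : Delta k hg c = (c == (hg, hg))%:R.
Proof.
rewrite DeltaE /= (@eq_filter _ _ pred0) ?filter_pred0 => [|x]; last first.
  by rewrite inE.
rewrite ffunE; case: c => [[a S] [b T]] /=; rewrite !xpair_eqE.
by case: a; case: b.
Qed.

Lemma Delta_set1 (j : bool) i (c : HB m * HB m) : Delta k (j, [set i]) c =
  (c == ((j, [set i]), (j, set0)))%:R + (c == ((~~ j, set0), (j, [set i])))%:R.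
Proof.
rewrite DeltaE /= (@eq_filter _ _ (pred1 i)) => [|x]; last by rewrite !inE.
rewrite filter_pred1_uniq ?enum_uniq ?mem_enum // /DeltaXs /= mulHH_unitr.
rewrite !ffunE; case: c => [[a S] [b T]] /=; rewrite !xpair_eqE.
by case: j; case: a; case: b.
Qed.

End Basis.

(** * Products in A (x) H and A (x) H (x) H *)

Section Products.
Variables (m : nat) (k : fieldType) (A : algType k).
Implicit Types (b c p q r : HB m) (i : 'I_m) (u v : {ffun HB m -> A}).

Lemma mulAH_ldiv u v c :
  mulAH u v c = \sum_(r : HB m | r.2 \subset c.2)
    (-1) ^+ hsign r (ldiv r c) *: (u r * v (ldiv r c)).
Proof.
rewrite ffunE [RHS]big_mkcond; apply: eq_bigr => r _.
exact: (sum_hcoefl r c (fun q => u r * v q)).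
Qed.

Lemma sum_HB (V : nmodType) (P : pred {set 'I_m}) (F : HB m -> V) :
  \sum_(r : HB m | P r.2) F r = \sum_(T | P T) F (false, T) + \sum_(T | P T) F (true, T).
Proof.
rewrite addrC; transitivity (\sum_(j : bool) \sum_(T | P T) F (j, T)).
  by rewrite pair_big; apply: eq_big => [r|[j T] _].
by rewrite big_bool.
Qed.

Lemma mulAH_deg0 u v (j : bool) :
  mulAH u v (j, set0) = u hunit * v (j, set0) + u hg * v (~~ j, set0).
Proof.
have sum1 (F : {set 'I_m} -> A) : \sum_(T : {set 'I_m} | T \subset set0) F T = F set0.
  by apply: big_pred1 => T; rewrite subset0.
rewrite mulAH_ldiv (sum_HB (fun T => T \subset _)) /= !sum1 /ldiv !hsign_l0 /=.
by rewrite setD0 !scale1r.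
Qed.

(** The signs in the second line come from moving a power of [g] leftwards past [x_i]; the two
    exponents there differ by one. *)
Lemma mulAH_deg1 u v (j : bool) i :
  mulAH u v (j, [set i]) =
    u hunit * v (j, [set i]) + u hg * v (~~ j, [set i])
    + (-1) ^+ j *: (u (hx i) * v (j, set0) - u (hgx i) * v (~~ j, set0)).
Proof.
have sum2 (F : {set 'I_m} -> A) :
    \sum_(T : {set 'I_m} | T \subset [set i]) F T = F set0 + F [set i].
  rewrite (bigD1 set0) ?sub0set //=; congr (_ + _); apply: big_pred1 => T /=.
  rewrite subset1 andb_orl andbN orbF; case: eqP => //= ->.
  by rewrite -cards_eq0 cards1.
rewrite mulAH_ldiv (sum_HB (fun T => T \subset _)) /= !sum2 /ldiv !hsign_l0 /=.
rewrite setDv setD0 !hsign_r0 /= cards1 !muln1 !scale1r scalerBr.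
by rewrite addrACA; case: j; rewrite /= ?scale1r ?scaleN1r ?opprK.
Qed.

Variable rho : A -> {ffun HB m -> A}.
Implicit Types (X : {ffun HB m * HB m -> A}) (s : HB m * HB m).

(** The second leg of [rho(1) (x) 1] is the unit, so the second leg of [X] is a spectator and the
    product takes place in A (x) H. *)
Lemma mulAHH_rho1l X s :
  mulAHH (rho1_1 rho) X s = mulAH (rho 1) [ffun b => X (b, s.2)] s.1.
Proof.
rewrite !ffunE; transitivity (\sum_r \sum_t \sum_q
    (hcoef k r q.1 s.1 * hcoef k t q.2 s.2) *: (rho1_1 rho (r, t) * X q)).
  by rewrite [RHS]pair_big; apply: eq_bigr => -[r t] _.
apply: eq_bigr => r _.
rewrite (bigD1 hunit) //= [X in _ + X]big1 ?addr0 => [|t /negPf neq]; last first.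
  by apply: big1 => q _; rewrite [rho1_1 _ _]ffunE /= neq mul0r scaler0.
transitivity (\sum_q \sum_t
    (hcoef k r q s.1 * hcoef k hunit t s.2) *: (rho 1 r * X (q, t))).
  by rewrite [RHS]pair_big; apply: eq_bigr => -[q t] _; rewrite [rho1_1 _ _]ffunE /= eqxx.
apply: eq_bigr => q _.
rewrite (bigD1 s.2) //= [X in _ + X]big1 ?addr0 => [|t neq].
  by rewrite hcoef_unitl eqxx mulr1 ffunE.
by rewrite hcoef_unitl eq_sym (negPf neq) mulr0 scale0r.
Qed.

Lemma mulAHH_rho1r X s :
  mulAHH X (rho1_1 rho) s = mulAH [ffun b => X (b, s.2)] (rho 1) s.1.
Proof.
rewrite !ffunE; transitivity (\sum_r \sum_t \sum_q
    (hcoef k r q.1 s.1 * hcoef k t q.2 s.2) *: (X (r, t) * rho1_1 rho q)).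
  by rewrite [RHS]pair_big; apply: eq_bigr => -[r t] _.
apply: eq_bigr => r _; rewrite exchange_big /=.
transitivity (\sum_q \sum_z \sum_t
    (hcoef k r q s.1 * hcoef k t z s.2) *: (X (r, t) * rho1_1 rho (q, z))).
  by rewrite [RHS]pair_big; apply: eq_bigr => -[q z] _.
apply: eq_bigr => q _.
rewrite (bigD1 hunit) //= [X in _ + X]big1 ?addr0 => [|z /negPf neq]; last first.
  by apply: big1 => t _; rewrite [rho1_1 _ _]ffunE /= neq mulr0 scaler0.
rewrite (bigD1 s.2) //= [X in _ + X]big1 ?addr0 => [|t neq].
  by rewrite hcoef_unitr eqxx mulr1 !ffunE /= eqxx.
by rewrite hcoef_unitr eq_sym (negPf neq) mulr0 scale0r.
Qed.

End Products.

(** * The explicit coaction *)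

Section Formula.
Variables (m : nat) (k : fieldType) (A : algType k) (w : 'I_m -> A).
Hypothesis two_neq0 : (2 : k) != 0.
Hypothesis wC : forall i y, w i * y = y * w i.
Implicit Types (b c p q : HB m) (i j : 'I_m).

(** The family [w] is arbitrary here, so that the axioms can be checked without reference to a given
    [rho]. *)
Definition rho_w (a : A) : {ffun HB m -> A} :=
  2^-1 *: (tens a hunit + tens a hg) - \sum_i tens (w i * a) (hgx i).

Lemma sum_rho_w (f : HB m -> k) a :
  \sum_b f b *: rho_w a b =
    (2^-1 * (f hunit + f hg)) *: a - \sum_i f (hgx i) *: (w i * a).
Proof.
have sum_tens b0 y : \sum_b f b *: tens y b0 b = f b0 *: y.
  rewrite (bigD1 b0) //= [X in _ + X]big1 ?addr0 ?ffunE ?eqxx // => b neq.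
  by rewrite ffunE (negPf neq) scaler0.
have -> : \sum_b f b *: rho_w a b =
    2^-1 *: (\sum_b f b *: tens a hunit b + \sum_b f b *: tens a hg b)
    - \sum_i \sum_b f b *: tens (w i * a) (hgx i) b.
  rewrite exchange_big -big_split scaler_sumr -sumrB; apply: eq_bigr => b _.
  rewrite -scaler_sumr !ffunE sum_ffunE scalerBr.
  by rewrite /= -scalerDr !scalerA [2^-1 * _]mulrC.
rewrite !sum_tens -scalerDl scalerA; congr (_ - _).
by apply: eq_bigr => i _; rewrite sum_tens.
Qed.

Lemma rho_wE a c :
  rho_w a c = (2^-1 * ((c == hunit)%:R + (c == hg)%:R)) *: a
              - \sum_i (c == hgx i)%:R *: (w i * a).
Proof.
rewrite -(sum_rho_w (fun b => (c == b)%:R)) (bigD1 c) //= eqxx scale1r.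
by rewrite big1 ?addr0 // => b neq; rewrite eq_sym (negPf neq) scale0r.
Qed.

(** Multiplicativity and both coaction identities have right-hand sides of this shape for suitable
    scalars [H]. Each then reduces to comparing values of [H] on the elements [1], [g], [g x_i]. *)
Lemma sum2_rho_w (H : HB m -> HB m -> k) (a b : A) :
  \sum_p \sum_q H p q *: (rho_w a p * rho_w b q) =
    (2^-1 * 2^-1 * (H hunit hunit + H hunit hg + H hg hunit + H hg hg)) *: (a * b)
    - \sum_i (2^-1 * (H hunit (hgx i) + H hg (hgx i) + H (hgx i) hunit + H (hgx i) hg))
        *: (w i * (a * b))
    + \sum_i \sum_j H (hgx i) (hgx j) *: (w i * (w j * (a * b))).
Proof.
have in_q p : \sum_q H p q *: (rho_w a p * rho_w b q) =
    (2^-1 * (H p hunit + H p hg)) *: rho_w a p * b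
    - \sum_j H p (hgx j) *: rho_w a p * (w j * b).
  under eq_bigr do rewrite scalerAr.
  rewrite -mulr_sumr sum_rho_w mulrBr mulr_sumr -scalerAr scalerAl.
  by congr (_ - _); apply: eq_bigr => j _; rewrite -scalerAr scalerAl.
under eq_bigr do rewrite in_q.
rewrite sumrB exchange_big /= -mulr_suml.
under [X in _ - X]eq_bigr do rewrite -mulr_suml sum_rho_w mulrBl.
rewrite sum_rho_w mulrBl sumrB opprB addrA addrAC; congr (_ + _); last first.
  rewrite exchange_big; apply: eq_bigr => j _; rewrite mulr_suml.
  apply: eq_bigr => i _; rewrite -scalerAl; congr (_ *: _).
  (* Centrality carries [w j] to the left of [a]. *)
  by rewrite -!mulrA (mulrA a) -wC -!mulrA.
rewrite -addrA -opprD mulr_suml -big_split -scalerAl; congr (_ *: _ - _).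
  by ring.
apply: eq_bigr => i _ /=.
rewrite -!scalerAl (mulrA a) -(wC i a) -!mulrA -scalerDl; congr (_ *: _).
by ring.
Qed.

(** Exchanging [i] and [j] turns the sum into its own negative because the [w i] commute, and 2 is
    invertible. *)
Lemma sum_antisym (G : 'I_m -> 'I_m -> k) y : (forall i j, G i j = - G j i) ->
  \sum_i \sum_j G i j *: (w i * (w j * y)) = 0.
Proof.
move=> Ganti; set S := LHS; have SN : S = - S.
  rewrite {1}/S exchange_big -sumrN; apply: eq_bigr => i _; rewrite -sumrN.
  apply: eq_bigr => j _.
  by rewrite Ganti scaleNr mulrA (wC j (w i)) -mulrA.
have: (2 : k) *: S = 0 by rewrite scaler_nat mulr2n {1}SN addNr.
by move/eqP; rewrite scaler_eq0 (negPf two_neq0) => /eqP.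
Qed.

Lemma hcoef_hg c : hcoef k hg hg c = (c == hunit)%:R.
Proof. by rewrite /hcoef hsign_l0 /= -setI_eq0 setI0 setU0 eqxx /=; case: eqP. Qed.

Lemma hcoef_hg_hgx i c : hcoef k hg (hgx i) c = (c == hx i)%:R.
Proof. by rewrite /hcoef hsign_l0 /= -setI_eq0 set0I set0U eqxx /=; case: eqP. Qed.

Lemma hcoef_hgx_hg i c : hcoef k (hgx i) hg c = - (c == hx i)%:R.
Proof.
rewrite /hcoef hsign_r0 /= cards1 -setI_eq0 setI0 setU0 eqxx /=.
by case: eqP; rewrite ?oppr0.
Qed.

(** For distinct indices exactly one of the two orders has an inversion, while the sign from passing
    [g] is common to both. For equal indices both sides vanish. *)
Lemma hcoef_hgx_antisym i j c : hcoef k (hgx i) (hgx j) c = - hcoef k (hgx j) (hgx i) c.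
Proof.
have inv1 (x y : 'I_m) :
    #|[set p : 'I_m * 'I_m | (p.1 \in [set x]) && (p.2 \in [set y]) && (p.2 < p.1)%N]|
    = (y < x)%N.
  case yx: (y < x)%N; last first.
    by apply: eq_card0 => -[x' y']; rewrite !inE /=; do 2?case: eqP => // ->.
  rewrite /= -[RHS](cards1 (x, y)); apply: eq_card => -[x' y']; rewrite !inE /= xpair_eqE.
  by do 2?case: eqP => //= ->.
rewrite /hcoef /= [in RHS]setUC [in RHS]disjoint_sym.
case: ifP => [/andP[dij _]|_]; last by rewrite oppr0.
have: i != j by move: dij; rewrite disjoints1 inE.
rewrite /hsign /= !cards1 !inv1 neq_ltn.
by case: (ltngtP i j) => //= _ _; rewrite ?expr1 ?sqrrN ?expr1n ?opprK.
Qed.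

(** * Verification of the axioms for the explicit formula *)

Lemma rho_w_counit a : \sum_b epsH k b *: rho_w a b = a.
Proof.
rewrite sum_rho_w /epsH /= eqxx big1 => [|i _]; last first.
  by rewrite -cards_eq0 cards1 scale0r.
by rewrite subr0 -mulr2n mulVf // scale1r.
Qed.

Lemma rho_w_mul (a b : A) : rho_w (a * b) = mulAH (rho_w a) (rho_w b).
Proof.
apply/ffunP => c; rewrite [RHS]ffunE (sum2_rho_w (fun p q => hcoef k p q c)).
rewrite (sum_antisym (G := fun i j => hcoef k (hgx i) (hgx j) c)); last first.
  by move=> i j; exact: hcoef_hgx_antisym.
rewrite addr0 rho_wE !hcoef_unitl !hcoef_unitr !hcoef_hg; congr (_ *: _ - _).
  by field.
(* The four products of [1], [g] with [g x_i] add up to [2 g x_i]: the two occurrences of [x_i] have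
   opposite signs. *)
apply: eq_bigr => i _; congr (_ *: _).
by rewrite hcoef_unitl hcoef_unitr hcoef_hg_hgx hcoef_hgx_hg; field.
Qed.

Lemma rhoI_rho_w a (s : HB m * HB m) :
  rhoI_rho rho_w a s =
    (2^-1 * 2^-1 * (((s.1 == hunit)%:R + (s.1 == hg)%:R) *
       ((s.2 == hunit)%:R + (s.2 == hg)%:R))) *: a
    - \sum_i (2^-1 * (((s.1 == hunit)%:R + (s.1 == hg)%:R) * (s.2 == hgx i)%:R
              + (s.1 == hgx i)%:R * ((s.2 == hunit)%:R + (s.2 == hg)%:R))) *: (w i * a)
    + \sum_i \sum_j ((s.1 == hgx i)%:R * (s.2 == hgx j)%:R) *: (w i * (w j * a)).
Proof.
rewrite ffunE rho_wE [rho_w a s.2]rho_wE scalerBr scalerA.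
under [X in _ - X = _]eq_bigr do rewrite mulrBr scalerBr -scalerAr scalerA.
rewrite sumrB opprB addrA addrAC; congr (_ + _); last first.
  apply: eq_bigr => i _; rewrite mulr_sumr scaler_sumr; apply: eq_bigr => j _.
  by rewrite -scalerAr scalerA.
rewrite -addrA scaler_sumr -opprD -big_split; congr (_ *: _ - _); first by ring.
by apply: eq_bigr => i _ /=; rewrite scalerA -scalerDl; congr (_ *: _); ring.
Qed.

(** Absorbing the sum over [q] into a scalar weight on [e] gives the coaction axiom the shape
    required by [sum2_rho_w]. *)
Lemma sum_IDeltal (rho : A -> {ffun HB m -> A}) (f : HB m -> k) x a (s : HB m) :
  \sum_q f q *: (x * [ffun b => IDelta_rho rho a (b, s)] q) =
  \sum_e (\sum_q f q * Delta k e (q, s)) *: (x * rho a e).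
Proof.
under eq_bigr do rewrite !ffunE mulr_sumr scaler_sumr.
rewrite exchange_big; apply: eq_bigr => e _; rewrite scaler_suml.
by apply: eq_bigr => q _; rewrite -scalerAr scalerA.
Qed.

Lemma sum_IDeltar (rho : A -> {ffun HB m -> A}) (f : HB m -> k) x a (s : HB m) :
  \sum_q f q *: ([ffun b => IDelta_rho rho a (b, s)] q * x) =
  \sum_e (\sum_q f q * Delta k e (q, s)) *: (rho a e * x).
Proof.
under eq_bigr do rewrite !ffunE mulr_suml scaler_sumr.
rewrite exchange_big; apply: eq_bigr => e _; rewrite scaler_suml.
by apply: eq_bigr => q _; rewrite -scalerAl scalerA.
Qed.

Lemma sum_Delta_hunit (f : HB m -> k) c :
  \sum_q f q * Delta k hunit (q, c) = f hunit * (c == hunit)%:R.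
Proof.
rewrite (bigD1 hunit) //= big1 ?addr0 => [|q neq]; rewrite Delta_hunit xpair_eqE.
  by rewrite eqxx.
by rewrite (negPf neq) mulr0.
Qed.

Lemma sum_Delta_hg (f : HB m -> k) c :
  \sum_q f q * Delta k hg (q, c) = f hg * (c == hg)%:R.
Proof.
rewrite (bigD1 hg) //= big1 ?addr0 => [|q neq]; rewrite Delta_hg xpair_eqE.
  by rewrite eqxx.
by rewrite (negPf neq) mulr0.
Qed.

Lemma sum_Delta_hgx (f : HB m -> k) i c :
  \sum_q f q * Delta k (hgx i) (q, c) =
    f (hgx i) * (c == hg)%:R + f hunit * (c == hgx i)%:R.
Proof.
under eq_bigr do rewrite Delta_set1 mulrDr !xpair_eqE.
rewrite big_split /=; congr (_ + _).
  rewrite (bigD1 (hgx i)) //= big1 ?addr0 ?eqxx // => q neq.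
  by rewrite (negPf neq) mulr0.
rewrite (bigD1 hunit) //= big1 ?addr0 ?eqxx // => q neq.
by rewrite (negPf neq) mulr0.
Qed.

Definition sum_DeltaE := (sum_Delta_hunit, sum_Delta_hg, sum_Delta_hgx).

Lemma rho_w_coaction a : rhoI_rho rho_w a = mulAHH (rho1_1 rho_w) (IDelta_rho rho_w a).
Proof.
apply/ffunP => s; rewrite mulAHH_rho1l [RHS]ffunE rhoI_rho_w.
under [RHS]eq_bigr do rewrite sum_IDeltal.
rewrite (sum2_rho_w (fun p e => \sum_q hcoef k p q s.1 * Delta k e (q, s.2))).
rewrite !sum_DeltaE !hcoef_unitl !hcoef_unitr !hcoef_hg mul1r.
congr (_ *: _ - _ + _); first by field.
  apply: eq_bigr => i _; congr (_ *: _); rewrite !sum_DeltaE.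
  by rewrite !hcoef_unitl !hcoef_unitr hcoef_hg_hgx hcoef_hgx_hg; field.
(* [Delta (g x_j)] has two terms. The one with right leg [g] gives an antisymmetric weight and
   cancels; the one with right leg [g x_j] matches the left side. *)
under [RHS]eq_bigr => i _ do under eq_bigr => j _ do
  rewrite sum_DeltaE hcoef_unitr scalerDl.
under [RHS]eq_bigr => i _ do rewrite big_split /=.
rewrite big_split /= [X in _ = X + _]sum_antisym ?add0r // => i j.
by rewrite hcoef_hgx_antisym mulNr.
Qed.

Lemma rho_w_symmetric a : rhoI_rho rho_w a = mulAHH (IDelta_rho rho_w a) (rho1_1 rho_w).
Proof.
apply/ffunP => s; rewrite mulAHH_rho1r [RHS]ffunE rhoI_rho_w [RHS]exchange_big /=.
under [RHS]eq_bigr do rewrite sum_IDeltar.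
rewrite [RHS]exchange_big.
rewrite (sum2_rho_w (fun e p => \sum_q hcoef k q p s.1 * Delta k e (q, s.2))).
rewrite !sum_DeltaE !hcoef_unitl !hcoef_unitr !hcoef_hg mulr1.
congr (_ *: _ - _ + _); first by field.
  apply: eq_bigr => i _; congr (_ *: _); rewrite !sum_DeltaE.
  by rewrite !hcoef_unitl !hcoef_unitr hcoef_hg_hgx hcoef_hgx_hg; field.
under [RHS]eq_bigr => i _ do under eq_bigr => j _ do
  rewrite sum_DeltaE hcoef_unitl scalerDl.
under [RHS]eq_bigr => i _ do rewrite big_split /=.
rewrite big_split /= [X in _ = X + _]sum_antisym ?add0r => [|i j]; last first.
  by rewrite hcoef_hgx_antisym mulNr.
(* With [rho 1] on the right the surviving indices appear in the opposite order, so commutativity of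
   the [w i] is needed once more. *)
rewrite exchange_big; apply: eq_bigr => i _; apply: eq_bigr => j _.
by rewrite mulrA (wC j (w i)) -mulrA.
Qed.

End Formula.

(** * Coefficients of a partial coaction *)

Section Forward.
Variables (m : nat) (k : fieldType) (A : algType k) (rho : A -> {ffun HB m -> A}).
Hypothesis two_neq0 : (2 : k) != 0.
Hypothesis rhoZ : forall (c : k) a, rho (c *: a) = c *: rho a.
Hypothesis rho_coact : is_partial_coaction rho.
Hypothesis rho1_eq : rho 1 hunit = rho 1 hg.
Local Notation w i := (rho 1 (hx i) - rho 1 (hgx i)).
Hypothesis wC : forall (i : 'I_m) (y : A), w i * y = y * w i.
Implicit Types (b c e : HB m) (i s t : 'I_m) (S T : {set 'I_m}) (j h : bool).

(** By [Delta_supp], the two legs determine the basis element whose coproduct can contain them. *)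
Lemma IDelta_rhoE a b c :
  IDelta_rho rho a (b, c) =
    Delta k (c.1, b.2 :|: c.2) (b, c) *: rho a (c.1, b.2 :|: c.2).
Proof.
rewrite ffunE (bigD1 (c.1, b.2 :|: c.2)) //= big1 ?addr0 // => -[j S] neq.
rewrite Delta_eq0 ?scale0r //; apply: contra neq => /and3P[/= /eqP <- _ /forallP HS].
rewrite xpair_eqE eqxx /=; apply/eqP/setP => x; rewrite inE.
by move: (HS x) => /=; case: (x \in b.2); case: (x \in c.2); case: (x \in S).
Qed.

Lemma rho_coactE a b c :
  rho (rho a c) b = mulAH (rho 1) [ffun p => IDelta_rho rho a (p, c)] b.
Proof.
case: rho_coact => _ _ /(_ a)/ffunP/(_ (b, c)).
by rewrite mulAHH_rho1l ffunE.
Qed.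

(** * Coefficients of degree zero and one *)

Lemma half_add (a : A) : 2^-1 *: (a + a) = a.
Proof. by rewrite -mulr2n -scaler_nat scalerA mulVf // scale1r. Qed.

Lemma rho_deg0_sum a : rho a hunit + rho a hg = a.
Proof.
case: rho_coact => /(_ a) E _ _; rewrite -[RHS]E.
rewrite (bigID (fun b : HB m => b.2 == set0)) /= [X in _ = _ + X]big1 => [|b neq]; last first.
  by rewrite /epsH (negPf neq) scale0r.
rewrite addr0 (sum_HB (fun T => T == set0)) /= !big_pred1_eq /epsH /= eqxx.
by rewrite !scale1r.
Qed.

Lemma rho1_deg0 j : rho 1 (j, set0) = 2^-1 *: 1.
Proof.
rewrite -[in RHS](rho_deg0_sum 1) rho1_eq half_add.
by case: j; rewrite // -rho1_eq.
Qed.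

Lemma rho_deg0 a j : rho a (j, set0) = 2^-1 *: a.
Proof.
case: rho_coact => _ /(_ 1 a) E _.
rewrite -[in LHS](mul1r a) E mulAH_deg0 !rho1_deg0 -!scalerAl !mul1r -scalerDr.
by congr (_ *: _); rewrite -[RHS]rho_deg0_sum; case: j => //=; rewrite addrC.
Qed.

Lemma IDelta_rho_hunit a b : (#|b.2| <= 1)%N ->
  IDelta_rho rho a (b, hunit) = if b.1 then 0 else rho a b.
Proof.
case: b => j S /= S1; rewrite IDelta_rhoE /= setU0; case: j.
  by rewrite Delta_eq0 ?scale0r // /Delta_supp /= cards0.
have [/eqP|S_gt0] := posnP #|S|.
  rewrite cards_eq0 => /eqP->.
  by rewrite [Delta _ _ _]Delta_hunit eqxx scale1r.
have /cards1P[i ->] : #|S| == 1%N by rewrite eqn_leq S1.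
by rewrite Delta_set1 eqxx !xpair_eqE addr0 scale1r.
Qed.

(** At [x_i (x) 1] the left side of the coaction axiom gives one half of this coefficient and the
    right side gives two halves. *)
Lemma rho1_hx i : rho 1 (hx i) = 0.
Proof.
have := rho_coactE 1 (hx i) hunit.
rewrite [rho 1 hunit]rho1_deg0 rhoZ [LHS]ffunE mulAH_deg1 !rho1_deg0.
have D j S : (#|S| <= 1)%N -> [ffun p => IDelta_rho rho 1 (p, hunit)] (j, S) =
    if j then 0 else rho 1 (false, S).
  by move=> S1; rewrite ffunE IDelta_rho_hunit //; case: j.
rewrite !D ?cards1 ?cards0 //= rho1_deg0 -scalerAl mul1r !mulr0 addr0 subr0 expr0 scale1r.
rewrite -[LHS]addr0 => /addrI/esym/eqP; rewrite -scalerAr mulr1 scaler_eq0.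
by rewrite invr_eq0 (negPf two_neq0) => /eqP.
Qed.

Lemma rho_deg1_left a i : rho a (hx i) - rho a (hgx i) = w i * a.
Proof.
case: rho_coact => _ /(_ 1 a) E _.
have: rho a (hx i) = rho (1 * a) (hx i) by rewrite mul1r.
rewrite E mulAH_deg1 !rho_deg0 /= expr0 scale1r -!scalerAr -scalerBr -mulrBl.
(* With [alpha], [beta] the coefficients at [x_i] and [g x_i], the equation is
   [alpha = 1/2 (alpha + beta + w_i a)]; doubling lets one [alpha] cancel. *)
rewrite -!scalerAl !mul1r -!scalerDr => /(congr1 ( *:%R 2)).
rewrite scalerA divff // scale1r scaler_nat mulr2n -addrA => /addrI ->.
by rewrite addrAC subrr add0r.
Qed.

Lemma rho_deg1_right a i : rho a (hx i) + rho a (hgx i) = - (a * w i).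
Proof.
case: rho_coact => _ /(_ a 1) E _.
have: rho a (hx i) = rho (a * 1) (hx i) by rewrite mulr1.
rewrite E mulAH_deg1 !rho_deg0 /= expr0 scale1r -!scalerAr -scalerBr.
rewrite -!scalerAl !mulr1 -!scalerDr => /(congr1 ( *:%R 2)).
rewrite scalerA divff // scale1r scaler_nat mulr2n addrCA => /addrI ->.
(* Since [rho 1 (hx i) = 0], the coefficient [rho 1 (hgx i)] is the negative of [w i]. *)
by rewrite subrK !rho1_hx sub0r mulrN opprK mulr0 add0r.
Qed.

Lemma rho_hx a i : rho a (hx i) = 0.
Proof.
rewrite -[LHS]half_add; apply/eqP; rewrite scaler_eq0; apply/orP; right.
by rewrite -{1}[rho a (hx i)](subrK (rho a (hgx i))) -addrA (addrC (rho a (hgx i)))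
  rho_deg1_left rho_deg1_right wC subrr.
Qed.

Lemma rho_hgx a i : rho a (hgx i) = - (w i * a).
Proof. by rewrite -rho_deg1_left rho_hx sub0r opprK. Qed.

(* For [s] in [S], compare coefficients of [x_(S :\ s) (x) g^j x_s] in the
   coaction axiom: by induction all terms vanish except
   [1/2 rho a (j, S)], up to sign. *)
Lemma rho_deg_gt1 a j S : (1 < #|S|)%N -> rho a (j, S) = 0.
Proof.
have [d] := ubnP #|S|; elim: d a j S => // d IHd a j S ltSd S_gt1.
(* Only exponent 0 of [g] is claimed, since in degree one the coefficient at [g x_i] is
   [- (w i * b)]. *)
have rho_lt (b : A) T : T != set0 -> (#|T| < #|S|)%N -> rho b (false, T) = 0.
  rewrite -card_gt0 => T_gt0 ltTS; have [T_gt1|T_le1] := ltnP 1 #|T|.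
    by apply: IHd => //; exact: leq_trans ltTS ltSd.
  have /cards1P[i ->] : #|T| == 1%N by rewrite eqn_leq T_le1.
  exact: rho_hx.
have [s sS] : exists s, s \in S by apply/card_gt0P; exact: ltnW.
have cardSs : #|S| = #|S :\ s|.+1 by rewrite (cardsD1 s) sS.
have Ss0 : S :\ s != set0 by rewrite -card_gt0 -ltnS -cardSs.
have := rho_coactE a (false, S :\ s) (j, [set s]).
(* Having [x_s] in the right leg puts an extra [g] in the left one, so among the degree-zero factors
   of [rho 1] only [g^(~~ j)] meets the support of [Delta]. *)
rewrite rho_lt ?cardSs // mulAH_ldiv /= (bigD1 (~~ j, set0)) ?sub0set //=.
rewrite big1 => [|[h R] /= /andP[sRS neq]].
  rewrite addr0 hsign_l0 scale1r rho1_deg0 -scalerAl mul1r ffunE IDelta_rhoE /ldiv /=.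
  rewrite addbF setD0 setUC setD1K // => /esym/eqP.
  (* This coefficient of [Delta] squares to 1, hence is nonzero and can be cancelled. *)
  have := Delta_spec k (j, S) ((~~ j, S :\ s), (j, [set s])).
  rewrite /Delta_supp /= cards1 addbT !eqxx /= ifT => [DD|]; last first.
    apply/forallP => x; rewrite !inE; case: (eqVneq x s) => [->|_]; first by rewrite sS.
    by case: (x \in S).
  rewrite scalerA scaler_eq0 mulf_eq0 invr_eq0 (negPf two_neq0) /=.
  case/orP => [/eqP D0|/eqP //].
  by move: DD; rewrite D0 mulr0 => /eqP; rewrite eq_sym oner_eq0.
rewrite ffunE IDelta_rhoE /ldiv /= addbF.
have [R0|R0] := eqVneq R set0.
  have hj : h = j by move: neq; rewrite R0 xpair_eqE eqxx andbT; case: h; case: (j).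
  rewrite hj R0 Delta_eq0 ?scale0r ?mulr0 ?scaler0 //.
  by rewrite /Delta_supp /= cards1 eqxx /=; case: (j).
have ltRS : (#|R| < #|S|)%N by rewrite cardSs ltnS subset_leq_card.
case: h neq => [_|_]; last by rewrite rho_lt // mul0r scaler0.
case: j => [|].
  by rewrite Delta_eq0 ?scale0r ?mulr0 ?scaler0 // /Delta_supp /= cards1.
(* Removing the nonempty [R] leaves a proper subset of [S] that still contains [s], at exponent 0 of
   [g]. *)
rewrite [rho a _]rho_lt ?scaler0 ?mulr0 ?scaler0 //.
  by rewrite -card_gt0 (cardsD1 s) !inE eqxx orbT.
have [t tR] := set0Pn _ R0.
rewrite proper_card // properE; apply/andP; split.
  apply/subsetP => x; rewrite !inE => /orP[/andP[_ /andP[]] //|/eqP->//].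
apply/subsetPn; exists t.
  by move/subsetP/(_ t tR): sRS; rewrite !inE => /andP[].
move/subsetP/(_ t tR): sRS; rewrite !inE => /andP[/negPf-> _].
by rewrite tR.
Qed.

Lemma rho_formula a : rho a = rho_w (fun i => w i) a.
Proof.
apply/ffunP => -[j S]; rewrite rho_wE.
have [S_gt1|] := ltnP 1 #|S|.
  have neq h T : (#|T| <= 1)%N -> ((j, S) == (h, T)) = false.
    by move=> T1; apply/eqP => -[_ ST]; move: T1; rewrite -ST leqNgt S_gt1.
  rewrite rho_deg_gt1 // /hunit /hg !neq ?cards0 // addr0 mulr0 scale0r sub0r.
  by rewrite big1 ?oppr0 // => i _; rewrite neq ?cards1 ?scale0r.
rewrite leq_eqVlt ltnS leqn0 cards_eq0 => /orP[/cards1P[s ->]|/eqP->]; last first.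
  rewrite rho_deg0 big1 => [|i _]; last first.
    by rewrite xpair_eqE [set0 == _]eq_sym -cards_eq0 cards1 andbF scale0r.
  by rewrite subr0 !xpair_eqE eqxx !andbT; case: j; rewrite /= ?addr0 ?add0r mulr1.
have s0 : ([set s] == set0) = false by rewrite -cards_eq0 cards1.
rewrite !xpair_eqE s0 !andbF addr0 mulr0 scale0r sub0r.
rewrite (bigD1 s) //= big1 => [|i neq]; last first.
  rewrite xpair_eqE (_ : (_ == [set i]) = false) ?andbF ?scale0r //.
  by apply: contraNF neq => /eqP/set1_inj->.
rewrite addr0 xpair_eqE eqxx andbT; case: j.
  by rewrite [LHS]rho_hgx scale1r.
by rewrite [LHS]rho_hx scale0r oppr0.
Qed.

End Forward.

Theorem theorem4p9 (k : fieldType) (n : nat) (A : algType k)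
    (rho : A -> {ffun HB n.-1 -> A})
    (hchar : (2 : k) != 0) (hn : (2 <= n)%N)
    (hlin : forall (c : k) (a a' : A), rho (c *: a + a') = c *: rho a + rho a')
    (hA1 : rho 1 hunit - rho 1 hg = 0)
    (hw : forall i : 'I_n.-1, forall y : A,
        (rho 1 (hx i) - rho 1 (hgx i)) * y = y * (rho 1 (hx i) - rho 1 (hgx i))) :
  (is_partial_coaction rho <->
     forall a : A,
       rho a = (2 : k)^-1 *: (tens a hunit + tens a hg)
               - \sum_(i < n.-1) tens ((rho 1 (hx i) - rho 1 (hgx i)) * a) (hgx i))
  /\ (is_partial_coaction rho -> is_symmetric_partial_coaction rho).
Proof.
set w := fun i : 'I_n.-1 => rho 1 (hx i) - rho 1 (hgx i).
have rho0 : rho 0 = 0.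
  have := hlin 1 0 0; rewrite !scale1r addr0 -{1}[rho 0]addr0.
  by move/addrI/esym.
have rhoZ c a : rho (c *: a) = c *: rho a by rewrite -[c *: a]addr0 hlin rho0 addr0.
have formula : is_partial_coaction rho -> forall a, rho a = rho_w w a.
  by move=> rho_coact; apply: rho_formula => //; exact/subr0_eq.
have symm : (forall a, rho a = rho_w w a) -> is_symmetric_partial_coaction rho.
  move=> rhoE.
  (* The equality of [rho] and [rho_w w] is only pointwise, so it is transported through each
     operator separately. *)
  have EI a : rhoI_rho rho a = rhoI_rho (rho_w w) a.
    by apply/ffunP => s; rewrite [LHS]ffunE [RHS]ffunE !rhoE.
  have ED a : IDelta_rho rho a = IDelta_rho (rho_w w) a.
    apply/ffunP => s; rewrite [LHS]ffunE [RHS]ffunE.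
    by apply: eq_bigr => e _; rewrite rhoE.
  have E1 : rho1_1 rho = rho1_1 (rho_w w).
    by apply/ffunP => s; rewrite [LHS]ffunE [RHS]ffunE rhoE.
  split; last by move=> a; rewrite EI ED E1 rho_w_symmetric.
  split=> [a|a b|a]; first by rewrite rhoE rho_w_counit.
    by rewrite !rhoE rho_w_mul.
  by rewrite EI ED E1 rho_w_coaction.
by split; [split=> [/formula|/symm[]] | move/formula/symm].
Qed.
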